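(* Let $f(\xi)=\sum_{i,j,k,\ell=1}^3 C_{ijk\ell}\,\xi_{ij}\xi_{k\ell}$, $\xi\in\mathbb R^{3\times 3}$, be a real quadratic form (with $C$ a real fourth-order tensor) that is quasiconvex. Let $T(y)$ be the $y$-matrix (acoustic tensor) of $f$. Assume that $\det T(y)=0$ for all $y\in\mathbb R^3$. Then $f$ is extremal or $f$ is polyconvex.
   Context: Quasiconvexity: a quadratic form $f$ on $\mathbb R^{3\times 3}$ is quasiconvex (for quadratic forms this is equivalent to rank-one convexity) if and only if $f(x\otimes y)\ge 0$ for all $x,y\in\mathbb R^3$, where $x\otimes y=(x_iy_j)_{i,j}$. This may be taken as the definition. One writes $f(x,y)$ for $f(x\otimes y)$. $y$-matrix (acoustic tensor): the unique symmetric $3\times 3$ matrix $T(y)$, whose entries are quadratic forms in $y$, such that $f(x\otimes y)=x\,T(y)\,x^T$ for all $x,y\in\mathbb R^3$ ($x$ a row vector). Rank-one form: the square $\big(\sum_{i,j}b_{ij}\xi_{ij}\big)^2$ of a (nonzero) linear form on $\mathbb R^{3\times 3}$. Extremal form: a quasiconvex quadratic form $f$ is extremal if one cannot subtract a rank-one form from it while preserving quasiconvexity, i.e. there is no nonzero matrix $B\in\mathbb R^{3\times 3}$ with $f(x\otimes y)-(xBy^T)^2\ge 0$ for all $x,y\in\mathbb R^3$. Polyconvexity: a quadratic form $f$ on $\mathbb R^{3\times 3}$ is polyconvex if and only if it is the sum of a convex (i.e. positive semidefinite) quadratic form and a linear combination of the $2\times 2$ minors of $\xi$ (a quadratic Null-Lagrangian);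 equivalently, $f(x\otimes y)$ is a sum of squares of real linear combinations of the products $x_iy_j$. This may be taken as the definition. *)

(* Defs.v *)
From HB Require Import structures.
From mathcomp Require Import all_boot all_order all_algebra.
From mathcomp Require Import ring lra.
From mathcomp Require Import reals.

Set Implicit Arguments.
Unset Strict Implicit.
Unset Printing Implicit Defensive.

Import Order.TTheory GRing.Theory Num.Theory.
Local Open Scope ring_scope.

(* Vectors x, y of R^3 are row vectors. *)
Definition tensor (R : realType) (x y : 'rV[R]_3) : 'M[R]_3 := x^T *m y.

Definition quad_form (R : realType) (C : 'I_3 -> 'I_3 -> 'I_3 -> 'I_3 -> R)
    (xi : 'M[R]_3) : R :=
  \sum_(i < 3) \sum_(j < 3) \sum_(k < 3) \sum_(l < 3)
    C i j k l * xi i j * xi k l.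

Definition quasiconvex (R : realType) (f : 'M[R]_3 -> R) : Prop :=
  forall x y : 'rV[R]_3, 0 <= f (tensor x y).

Definition is_y_matrix (R : realType) (f : 'M[R]_3 -> R)
    (T : 'rV[R]_3 -> 'M[R]_3) : Prop :=
  [/\ forall y, (T y)^T = T y,
      exists D : 'I_3 -> 'I_3 -> 'M[R]_3,
        forall y i k, T y i k = (y *m D i k *m y^T) 0 0 &
      forall x y, f (tensor x y) = (x *m T y *m x^T) 0 0].

Definition rank_one_form (R : realType) (B : 'M[R]_3) (xi : 'M[R]_3) : R :=
  (\sum_(i < 3) \sum_(j < 3) B i j * xi i j) ^+ 2.

Definition extremal (R : realType) (f : 'M[R]_3 -> R) : Prop :=
  quasiconvex f /\
  ~ (exists B : 'M[R]_3,
       B != 0 /\ quasiconvex (fun xi => f xi - rank_one_form B xi)).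

(* \det (row' i (col' j xi)) is the 2 x 2 minor of xi obtained by deleting
   row i and column j. *)
Definition minors_comb (R : realType) (A : 'M[R]_3) (xi : 'M[R]_3) : R :=
  \sum_(i < 3) \sum_(j < 3) A i j * \det (row' i (col' j xi)).

(* The quadratic form quad_form D is convex iff it is nonnegative. *)
Definition polyconvex (R : realType) (f : 'M[R]_3 -> R) : Prop :=
  exists (D : 'I_3 -> 'I_3 -> 'I_3 -> 'I_3 -> R) (A : 'M[R]_3),
    (forall xi, 0 <= quad_form D xi) /\
    (forall xi, f xi = quad_form D xi + minors_comb A xi).

Lemma y_matrix_exists (R : realType)
    (C : 'I_3 -> 'I_3 -> 'I_3 -> 'I_3 -> R) :
  exists T, is_y_matrix (quad_form C) T.
Proof.
pose D i k : 'M[R]_3 := \matrix_(j, l) ((C i j k l + C k j i l) / 2).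
exists (fun y => \matrix_(i, k) (y *m D i k *m y^T) 0 0); split.
- move=> y; apply/matrixP => i k; rewrite !mxE.
  apply: eq_bigr => l _; rewrite !mxE; congr (_ * _).
  by apply: eq_bigr => j _; rewrite !mxE [C k _ _ _ + _]addrC.
- by exists D => y i k; rewrite mxE.
- move=> x y; rewrite /quad_form /tensor /D.
  do 8!rewrite ?mxE ?big_ord_recl ?big_ord0 /=.
  by field.
Qed.

Lemma y_matrix_unique (R : realType) (f : 'M[R]_3 -> R) T1 T2 :
  is_y_matrix f T1 -> is_y_matrix f T2 -> T1 =1 T2.
Proof.
move=> [s1 _ e1] [s2 _ e2] y.
have eqQ (x : 'rV_3) : (x *m T1 y *m x^T) 0 0 = (x *m T2 y *m x^T) 0 0.
  by rewrite -e1 -e2.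
have bil (M : 'M[R]_3) i k :
    (delta_mx (0 : 'I_1) i *m M *m (delta_mx (0 : 'I_1) k)^T) 0 0 = M i k.
  by rewrite trmx_delta -rowE -colE !mxE.
apply/matrixP => i k.
have := eqQ (delta_mx 0 i + delta_mx 0 k).
rewrite linearD /= !mulmxDl !mulmxDr ![(_ + _ : 'M__) 0 0]mxE !bil.
have := eqQ (delta_mx 0 i); have := eqQ (delta_mx 0 k); rewrite !bil.
have /matrixP/(_ i k) := s1 y; have /matrixP/(_ i k) := s2 y; rewrite !mxE.
lra.
Qed.

(* Main.v *)
(* Write f(x, y) = x T(y) x^T.

   Peeling. If f(., y0) is the square of a linear form w for some y0 != 0,
   then nonnegativity of s |-> f(x, y + s y0) forces f = h^2 + g with h
   bilinear, g nonnegative and independent of the component of y along y0.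
   Hence f is a sum of squares as soon as all nonnegative forms with one
   y-variable fewer are. Repeated peeling at zeros (created, if needed, by
   subtracting the largest possible multiple of (x_0 y_0)^2) gives Calderon's
   theorem for 2 x n forms, and so a 3 x 3 form is a sum of squares as soon as
   T(y0) has rank at most 1 for some y0 != 0.

   If f is not extremal, f >= b^2 with b(x, y) = x B y^T = x . u(y). Suppose
   T(y) has rank 2 for all y != 0. Then the matrices T - t u u^T all have
   determinant 0, and the sum of their principal 2 x 2 minors is
   alpha(y) - t beta(y) with alpha > 0. For 1/t = max beta/alpha over the sphere,
   f - t b^2 is still nonnegative, and its matrix has rank at most 1 at a
   maximizer. *)

Require Import Defs.
From mathcomp Require Import all_boot all_order all_algebra.
From mathcomp Require Import ring lra.
From mathcomp Require Import boolp classical_sets reals topology normedtype derive.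

Set Implicit Arguments.
Unset Strict Implicit.
Unset Printing Implicit Defensive.

Import Order.TTheory GRing.Theory Num.Theory.
Import numFieldNormedType.Exports.
Local Open Scope classical_set_scope.
Local Open Scope ring_scope.

(** * Biquadratic forms and sums of squares *)

Definition bilinear_form (R : realType) (U V : lmodType R) (b : U -> V -> R) :=
  (forall a x z y, b (a *: x + z) y = a * b x y + b z y) /\
  (forall a x y z, b x (a *: y + z) = a * b x y + b x z).

(* A biquadratic form f(x, y) is handled through its polarization, the
   4-linear map F with f(x, y) = F x x y y. *)
Record biquadratic (R : realType) (U V : lmodType R)
    (F : U -> U -> V -> V -> R) : Prop := Biquadratic {
  bqCl : forall x z y y', F x z y y' = F z x y y';
  bqCr : forall x z y y', F x z y y' = F x z y' y;
  bqPl : forall a x z t y y', F (a *: x + z) t y y' = a * F x t y y' + F z t y y';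
  bqPr : forall a x z y t y',
    F x z (a *: y + t) y' = a * F x z y y' + F x z t y' }.

Definition psd (R : realType) (U V : lmodType R) (F : U -> U -> V -> V -> R) :=
  forall x y, 0 <= F x x y y.

(** The length of the sum is not recorded and the equations are pointwise, so closure properties
    follow by plain induction. *)
Inductive sos (R : realType) (U V : lmodType R) : (U -> V -> R) -> Prop :=
| sos0 f : (forall x y, f x y = 0) -> sos f
| sosS f g b : bilinear_form b -> sos g ->
    (forall x y, f x y = b x y ^+ 2 + g x y) -> sos f.

Lemma sos_swap (R : realType) (U V : lmodType R) (f : U -> V -> R) :
  sos f -> sos (fun y x => f x y).
Proof.
elim=> {f} [f f0|f g b [bl br] _ sg fE]; first exact: sos0.
by apply: (sosS (b := fun y x => b x y) _ sg) => //; split=> *; rewrite ?bl ?br.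
Qed.

Lemma sos_comp (R : realType) (U V W : lmodType R) (r : W -> V)
    (rP : forall a y z, r (a *: y + z) = a *: r y + r z) (f : U -> V -> R) :
  sos f -> sos (fun x y => f x (r y)).
Proof.
move=> sf; elim: sf => {f} [f f0|f g b [bl br] _ sg fE].
  by apply: sos0 => x y; rewrite f0.
apply: (sosS (b := fun x y => b x (r y)) _ sg) => //.
by split=> *; rewrite ?rP ?bl ?br.
Qed.

Lemma biquadratic_swap (R : realType) (U V : lmodType R)
    (F : U -> U -> V -> V -> R) :
  biquadratic F -> biquadratic (fun y y' x x' => F x x' y y').
Proof. by case=> Cl Cr Pl Pr; split=> *; [exact: Cr|exact: Cl|exact: Pr|exact: Pl]. Qed.

Lemma biquadratic_comp (R : realType) (U V W : lmodType R) (i : W -> V)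
    (iP : forall a y z, i (a *: y + z) = a *: i y + i z)
    (F : U -> U -> V -> V -> R) :
  biquadratic F -> biquadratic (fun x x' y y' => F x x' (i y) (i y')).
Proof.
by case=> Cl Cr Pl Pr; split=> *; rewrite ?iP; [exact: Cl|exact: Cr|exact: Pl|exact: Pr].
Qed.

(** The subtracted term is the polarization of [t * b x y ^+ 2]; averaging the two pairings of
    arguments gives both symmetries. *)
Lemma biquadratic_sub_square (R : realType) (U V : lmodType R)
    (F : U -> U -> V -> V -> R) (b : U -> V -> R) (t : R) :
  biquadratic F -> bilinear_form b ->
  biquadratic (fun x z y y' =>
    F x z y y' - t * (b x y * b z y' + b x y' * b z y) / 2).
Proof.
case=> Cl Cr Pl Pr [bl br]; split=> *.
- by rewrite Cl; ring.
- by rewrite Cr; ring.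
- by rewrite Pl !bl; ring.
- by rewrite Pr !br; ring.
Qed.

Lemma biquadratic_expandr (R : realType) (U V : lmodType R)
    (F : U -> U -> V -> V -> R) (s : R) x y z :
  biquadratic F ->
  F x x (s *: z + y) (s *: z + y) =
  F x x y y + 2 * s * F x x z y + s ^+ 2 * F x x z z.
Proof.
by case=> Cl Cr Pl Pr; rewrite Pr 2![F x x _ (_ + _)]Cr !Pr [F x x y z]Cr; ring.
Qed.

Lemma biquadratic_expandl (R : realType) (U V : lmodType R)
    (F : U -> U -> V -> V -> R) (s : R) x z y y' :
  biquadratic F ->
  F (s *: z + x) (s *: z + x) y y' =
  F x x y y' + 2 * s * F z x y y' + s ^+ 2 * F z z y y'.
Proof.
by case=> Cl Cr Pl Pr; rewrite Pl 2![F _ (_ + _) _ _]Cl !Pl [F x z _ _]Cl; ring.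
Qed.

(** * Splitting off a square *)

Lemma linear_coef_eq0 (R : realType) (a b : R) :
  (forall s, 0 <= a + 2 * s * b) -> b = 0.
Proof.
move=> h; apply/eqP; apply: contraT => b0.
have := h (- (a + 1) / (2 * b)).
have -> : a + 2 * (- (a + 1) / (2 * b)) * b = -1 by field.
by rewrite lerNr oppr0 ler10.
Qed.

(** An explicit small [s] replaces the limit at 0. *)
Lemma quadratic_limit_ge0 (R : realType) (a b c : R) :
  (forall s, s != 0 -> 0 <= a + 2 * s * b + s ^+ 2 * c) -> 0 <= a.
Proof.
move=> h; rewrite leNgt; apply/negP => a0.
(* The summand [- a] makes [k] positive and [s <= 1]. Since [s * k = - a / 2], the polynomial at [s]
   is at most [a / 2 + s * a < 0]. *)
pose k := 2 * `|b| + `|c| - a.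
have k0 : 0 < k by rewrite /k; have := normr_ge0 b; have := normr_ge0 c; lra.
pose s := - a / (2 * k).
have s0 : 0 < s by rewrite divr_gt0 ?oppr_gt0 ?mulr_gt0.
have s1 : s <= 1.
  rewrite ler_pdivrMr ?mulr_gt0 // /k.
  by have := normr_ge0 b; have := normr_ge0 c; lra.
have := h s (lt0r_neq0 s0).
have sb : s * b <= s * `|b| by rewrite ler_pM2l // ler_norm.
have sc : s ^+ 2 * c <= s * `|c|.
  rewrite expr2 -mulrA ler_pM2l //; apply: (le_trans (y := s * `|c|)).
    by rewrite ler_pM2l // ler_norm.
  by rewrite ler_piMl.
have sk : s * k = - a / 2 by rewrite /s; field; rewrite lt0r_neq0.
move: sk; rewrite /k => sk; have : s * a < 0 by rewrite pmulr_rlt0.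
lra.
Qed.

(* If [w x1 = 1], dividing the linear coefficient of [F x x _ _] along [y0] by
   [w] gives [h x y = 2 F x1 x y0 y - w x F x1 x1 y0 y]; the division is exact
   because nonnegativity forces this coefficient to vanish on [ker w]. *)
Lemma split_square (R : realType) (U V : lmodType R)
    (F : U -> U -> V -> V -> R) (y0 : V) (w : U -> R) :
  biquadratic F -> psd F ->
  (forall a x z, w (a *: x + z) = a * w x + w z) ->
  (forall x, F x x y0 y0 = w x ^+ 2) ->
  exists h G, [/\ bilinear_form h, biquadratic G, psd G,
    (forall x y, F x x y y = h x y ^+ 2 + G x x y y) &
    (forall x z y, G x z y0 y = 0)].
Proof.
move=> bqF psdF wP Fw; have [Cl Cr Pl Pr] := bqF.
(* On the kernel of [w] the dependence on [s] is affine, and a nonnegative affine function has slope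
   0. *)
have ker0 x y : w x = 0 -> F x x y0 y = 0.
  move=> wx; apply: (@linear_coef_eq0 _ (F x x y y)) => s.
  have := psdF x (s *: y0 + y).
  by rewrite biquadratic_expandr // Fw wx expr0n mulr0 addr0.
have [w0|] := pselect (forall x, w x = 0).
  exists (fun _ _ => 0), F; split=> //.
  - by split=> *; rewrite mulr0 addr0.
  - by move=> x y; rewrite expr0n add0r.
  - move=> x z y; have := ker0 (1 *: z + x) y (w0 _).
    by rewrite biquadratic_expandl // !ker0 // [F z x _ _]Cl; lra.
move=> /existsNP[x2 /eqP wx2].
have w00 : w 0 = 0.
  by have := wP 1 0 0; rewrite scaler0 addr0; lra.
have wZ a x : w (a *: x) = a * w x by rewrite -[a *: x]addr0 wP w00 addr0.
pose x1 := (w x2)^-1 *: x2.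
have wx1 : w x1 = 1 by rewrite wZ mulVf.
have Fww x z : F x z y0 y0 = w x * w z.
  have := Fw (1 *: z + x); rewrite biquadratic_expandl // !Fw wP [F z x _ _]Cl.
  lra.
pose h x y := 2 * F x1 x y0 y - w x * F x1 x1 y0 y.
have hP : bilinear_form h.
  split=> a x z y; rewrite /h.
    by rewrite [F x1 _ _ _]Cl Pl wP ![F _ x1 _ y]Cl; ring.
  by rewrite ![F _ _ y0 _]Cr !Pr; ring.
have Fh x y : F x x y0 y = w x * h x y.
  (* The vector [- w x *: x1 + x] lies in the kernel of [w]. *)
  have := ker0 (- w x *: x1 + x) y; rewrite wP wx1 mulr1 addNr => /(_ erefl).
  by rewrite biquadratic_expandl // /h => E; lra.
have hy0 x : h x y0 = w x by rewrite /h !Fww wx1; ring.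
have Fh2 x z y : 2 * F x z y0 y = w x * h z y + w z * h x y.
  have [hl hr] := hP.
  have := Fh (1 *: z + x) y; rewrite biquadratic_expandl // !Fh wP hl [F z x _ _]Cl.
  lra.
have bqG := biquadratic_sub_square 1 bqF hP.
exists h, (fun x z y y' => F x z y y' - 1 * (h x y * h z y' + h x y' * h z y) / 2).
split=> //; last 2 first.
- by move=> x y; field.
- by move=> x z y; rewrite !hy0; have := Fh2 x z y; lra.
move=> x y.
suff : 0 <= F x x y y - h x y ^+ 2 by lra.
have pos x' : w x' != 0 -> 0 <= F x' x' y y - h x' y ^+ 2.
  (* The coefficient of [y0] is the minimizer of the quadratic polynomial in [s]; the minimum is the
     claimed difference. *)
  move=> wx; have := psdF x' (- (h x' y / w x') *: y0 + y).
  rewrite biquadratic_expandr // Fh Fw => H.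
  suff -> : F x' x' y y - h x' y ^+ 2 = F x' x' y y +
    2 * - (h x' y / w x') * (w x' * h x' y) + (- (h x' y / w x')) ^+ 2 * w x' ^+ 2
    by [].
  by field.
have [wx|] := eqVneq (w x) 0; last exact: pos.
(* At [s *: x1 + x] the form [w] takes the value [s], so the previous case covers every [s != 0],
   and [s] tends to 0. *)
apply: (@quadratic_limit_ge0 _ _ (F x1 x y y - h x y * h x1 y)
  (F x1 x1 y y - h x1 y ^+ 2)) => s s0.
have := pos (s *: x1 + x); rewrite wP wx wx1 mulr1 addr0 => /(_ s0).
rewrite biquadratic_expandl // (hP.1) => H.
by move: H; congr (_ <= _); ring.
Qed.

(** Some coordinate [j] of [y0] is nonzero: subtracting a multiple of [y0] kills coordinate [j], [r]
    then deletes it, and [i] reinserts a 0. *)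
Lemma split_along (R : realType) (n : nat) (y0 : 'rV[R]_n.+1) :
  y0 != 0 ->
  exists (s : 'rV[R]_n.+1 -> R) (r : 'rV[R]_n.+1 -> 'rV[R]_n)
    (i : 'rV[R]_n -> 'rV[R]_n.+1),
  [/\ forall a y z, r (a *: y + z) = a *: r y + r z,
      forall a y z, i (a *: y + z) = a *: i y + i z &
      forall y, y = s y *: y0 + i (r y)].
Proof.
move=> /rV0Pn[j y0j].
exists (fun y => y 0 j / y0 0 j),
  (fun y => \row_k (y 0 (lift j k) - y 0 j / y0 0 j * y0 0 (lift j k))),
  (fun y => \row_k (if unlift j k is Some k' then y 0 k' else 0)).
split=> [a y z|a y z|y]; apply/rowP => k; rewrite !mxE; first by ring.
  by case: unliftP => [k' _|_]; rewrite ?mxE // mulr0 addr0.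
case: unliftP => [k' ->|->]; first by rewrite mxE; ring.
by rewrite addr0 divfK.
Qed.

(** The remainder [G] descends to the quotient by [y0]. The last hypothesis is abstract because it
    is the induction hypothesis for 2 x n forms, but Calderon's theorem for 3 x 3 forms. *)
Lemma sos_peel (R : realType) (U : lmodType R) (n : nat)
    (F : U -> U -> 'rV[R]_n.+1 -> 'rV[R]_n.+1 -> R) (y0 : 'rV[R]_n.+1)
    (w : U -> R) :
  biquadratic F -> psd F -> y0 != 0 ->
  (forall a x z, w (a *: x + z) = a * w x + w z) ->
  (forall x, F x x y0 y0 = w x ^+ 2) ->
  (forall G : U -> U -> 'rV[R]_n -> 'rV[R]_n -> R,
     biquadratic G -> psd G -> sos (fun x y => G x x y y)) ->
  sos (fun x y => F x x y y).
Proof.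
move=> bqF psdF y0N0 wP Fw IH.
have [h [G [hP bqG psdG FE G0]]] := split_square bqF psdF wP Fw.
have [s [r [i [rP iP yE]]]] := split_along y0N0.
have /(sos_comp rP) sG := IH _ (biquadratic_comp iP bqG) (fun x y => psdG x (i y)).
apply: (sosS hP sG) => x y; rewrite FE; congr (_ + _).
by rewrite {1 2}(yE y) biquadratic_expandr // !G0 !mulr0 !addr0.
Qed.

Lemma biquadraticZ (R : realType) (U V : lmodType R)
    (F : U -> U -> V -> V -> R) a b x y :
  biquadratic F ->
  F (a *: x) (a *: x) (b *: y) (b *: y) = a ^+ 2 * b ^+ 2 * F x x y y.
Proof.
case=> Cl Cr Pl Pr.
have Zl c u v z z' : F (c *: u) v z z' = c * F u v z z'.
  have := Pl c u 0 v z z'; have := Pl 1 0 0 v z z'.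
  by rewrite !addr0 scaler0; lra.
have Zr c u v z z' : F u v (c *: z) z' = c * F u v z z'.
  have := Pr c u v z 0 z'; have := Pr 1 u v 0 0 z'.
  by rewrite !addr0 scaler0; lra.
by rewrite Zl Cl Zl Zr Cr Zr; ring.
Qed.

(** A zero of a nonnegative quadratic form lies in its kernel; in dimension 2 only one other
    coordinate remains. *)
Lemma square_of_zero (R : realType) (V : lmodType R)
    (F : 'rV[R]_2 -> 'rV[R]_2 -> V -> V -> R) (x0 : 'rV[R]_2) (y0 : V) :
  biquadratic F -> psd F -> x0 != 0 -> F x0 x0 y0 y0 = 0 ->
  exists w : 'rV[R]_2 -> R,
    (forall a x z, w (a *: x + z) = a * w x + w z) /\
    (forall x, F x x y0 y0 = w x ^+ 2).
Proof.
move=> bqF psdF x0N0 F0.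
have Fx0 z : F x0 z y0 y0 = 0.
  apply: (@linear_coef_eq0 _ (F z z y0 y0)) => s.
  have := psdF (s *: x0 + z) y0.
  by rewrite biquadratic_expandl // F0 mulr0 addr0.
(* [p] is [x0] rotated by a quarter turn, and [N] is the squared Euclidean length of both. *)
pose p : 'rV[R]_2 := \row_k (if k == 0 then - x0 0 1 else x0 0 0).
pose N := x0 0 0 ^+ 2 + x0 0 1 ^+ 2.
have N0 : N != 0.
  apply: contraNN x0N0; rewrite paddr_eq0 ?sqr_ge0 // !sqrf_eq0 => /andP[/eqP a /eqP b].
  apply/eqP/rowP => k; rewrite mxE.
  by case: k => [[|[|//]] ?] /=; [rewrite -[RHS]a|rewrite -[RHS]b];
    congr (x0 _ _); apply: val_inj.
have xE (x : 'rV[R]_2) : x = ((x 0 0 * x0 0 0 + x 0 1 * x0 0 1) / N) *: x0 +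
    ((- x 0 0 * x0 0 1 + x 0 1 * x0 0 0) / N) *: p.
  apply/rowP => k; rewrite !mxE.
  case: k => [[|[|//]] ?] /=; rewrite ?[Ordinal _]ord1.
    by rewrite (_ : Ordinal _ = 0); [rewrite /N; field|exact: val_inj].
  by rewrite (_ : Ordinal _ = 1); [rewrite /N; field|exact: val_inj].
exists (fun x => Num.sqrt (F p p y0 y0) * ((- x 0 0 * x0 0 1 + x 0 1 * x0 0 0) / N)).
split=> [a x z|x]; first by rewrite !mxE; field.
rewrite {1 2}(xE x) biquadratic_expandl // Fx0 F0 !mulr0 !addr0.
have := biquadraticZ ((- x 0 0 * x0 0 1 + x 0 1 * x0 0 0) / N) 1 p y0 bqF.
by rewrite scale1r expr1n mulr1 => ->; rewrite [RHS]exprMn sqr_sqrtr ?psdF // mulrC.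
Qed.

(** * Maxima on products of spheres *)

Lemma linear_rowE (R : realType) (n : nat) (L : 'rV[R]_n -> R) :
  (forall a x z, L (a *: x + z) = a * L x + L z) ->
  forall x, L x = \sum_i x 0 i * L (delta_mx 0 i).
Proof.
move=> LP x; rewrite {1}(row_sum_delta x).
have L0 : L 0 = 0 by have := LP 1 0 0; rewrite scaler0 addr0; lra.
elim/big_rec2: _ => // i a z _ <-; exact: LP.
Qed.

Lemma bilinearE (R : realType) (m n : nat) (b : 'rV[R]_m -> 'rV[R]_n -> R) x y :
  bilinear_form b ->
  b x y = \sum_i \sum_j b (delta_mx 0 i) (delta_mx 0 j) * (x 0 i * y 0 j).
Proof.
move=> [bl br]; rewrite (linear_rowE (fun a u v => bl a u v y)).
apply: eq_bigr => i _; rewrite (linear_rowE (fun a => br a (delta_mx 0 i)) y).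
by rewrite mulr_sumr; apply: eq_bigr => j _; ring.
Qed.

Lemma continuous_coord_fst (R : realType) (m n : nat) (i : 'I_m) :
  continuous (fun z : 'rV[R]_m * 'rV[R]_n => z.1 0 i).
Proof.
move=> z; apply: (@continuous_comp _ _ _ fst (fun x : 'rV[R]_m => x 0 i)).
  exact: cvg_fst.
exact: coord_continuous.
Qed.

Lemma continuous_coord_snd (R : realType) (m n : nat) (i : 'I_n) :
  continuous (fun z : 'rV[R]_m * 'rV[R]_n => z.2 0 i).
Proof.
move=> z; apply: (@continuous_comp _ _ _ snd (fun x : 'rV[R]_n => x 0 i)).
  exact: cvg_snd.
exact: coord_continuous.
Qed.

Lemma continuous_sum (R : realType) (T : topologicalType) (n : nat)
    (F : 'I_n -> T -> R) :
  (forall i, continuous (F i)) -> continuous (fun x => \sum_i F i x).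
Proof.
move=> cF; elim: (index_enum _) => [|i r IH].
  by under eq_fun do rewrite big_nil; move=> x; exact: cvg_cst.
under eq_fun do rewrite big_cons.
by move=> x; apply: cvgD; [exact: cF|exact: IH].
Qed.

Lemma continuous_bilinear (R : realType) (m n : nat)
    (b : 'rV[R]_m -> 'rV[R]_n -> R) :
  bilinear_form b -> continuous (fun z => b z.1 z.2).
Proof.
move=> bP; under eq_fun do rewrite (bilinearE _ _ bP).
apply: continuous_sum => i; apply: continuous_sum => j z.
apply: cvgM; first exact: cvg_cst.
by apply: cvgM; [exact: continuous_coord_fst|exact: continuous_coord_snd].
Qed.

Lemma continuous_biquadratic (R : realType) (m n : nat)
    (F : 'rV[R]_m -> 'rV[R]_m -> 'rV[R]_n -> 'rV[R]_n -> R) :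
  biquadratic F -> continuous (fun z => F z.1 z.1 z.2 z.2).
Proof.
case=> Cl Cr Pl Pr; rewrite (_ : (fun z => _) = fun z : 'rV[R]_m * 'rV[R]_n =>
    \sum_i \sum_j (z.1 0 i * z.2 0 j) *
       F (delta_mx 0 i) z.1 (delta_mx 0 j) z.2); last first.
  apply/funext => z; rewrite (bilinearE (b := fun x y => F x z.1 y z.2)).
    by apply: eq_bigr => i _; apply: eq_bigr => j _; rewrite mulrC.
  by split=> *; rewrite ?Pl ?Pr.
apply: continuous_sum => i; apply: continuous_sum => j z.
apply: cvgM.
  by apply: cvgM; [exact: continuous_coord_fst|exact: continuous_coord_snd].
apply: (continuous_bilinear (b := fun x y => F (delta_mx 0 i) x (delta_mx 0 j) y)).
by split=> *; [rewrite Cl Pl !(Cl _ (delta_mx _ _))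
  |rewrite Cr Pr !(Cr _ _ _ (delta_mx _ _))].
Qed.

Lemma compact_sphere (R : realType) (n : nat) :
  compact [set x : 'rV[R]_n | `|x| = 1].
Proof.
apply: bounded_closed_compact.
  exists 1; split; first exact: num_real.
  by move=> M M1 x /= ->; exact: ltW.
apply: (@preimage_closed _ _ (fun x : 'rV[R]_n => `|x|) [set 1]).
  by move=> x _; exact: norm_continuous.
exact: closed_eq.
Qed.

(** The quotient [g / f] has bidegree 0, so its maximum over the compact product of unit spheres is
    a maximum over all nonzero pairs. *)
Lemma ratio_max (R : realType) (m n p q : nat)
    (f g : 'rV[R]_m.+1 -> 'rV[R]_n.+1 -> R) :
  continuous (fun z => f z.1 z.2) -> continuous (fun z => g z.1 z.2) ->
  (forall a b x y, f (a *: x) (b *: y) = a ^+ p * b ^+ q * f x y) ->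
  (forall a b x y, g (a *: x) (b *: y) = a ^+ p * b ^+ q * g x y) ->
  (forall x y, x != 0 -> y != 0 -> 0 < f x y) ->
  exists x0 y0, [/\ x0 != 0, y0 != 0 &
    forall x y, x != 0 -> y != 0 -> g x y * f x0 y0 <= g x0 y0 * f x y].
Proof.
move=> cf cg hf hg f0.
have N0 k (x : 'rV[R]_k) : `|x| = 1 -> x != 0.
  by move=> x1; rewrite -normr_eq0 x1 oner_neq0.
have N1 k (x : 'rV[R]_k) : x != 0 -> `| `|x|^-1 *: x| = 1.
  by move=> x0; rewrite normrZ normfV normr_id mulVf ?normr_eq0.
have E1 k : exists x : 'rV[R]_k.+1, `|x| = 1.
  exists (`|const_mx 1 : 'rV[R]_k.+1|^-1 *: const_mx 1); apply: N1.
  by apply/rV0Pn; exists 0; rewrite mxE oner_neq0.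
pose A := [set x : 'rV[R]_m.+1 | `|x| = 1] `*` [set y : 'rV[R]_n.+1 | `|y| = 1].
have [|||[x0 y0] /set_mem[/= x01 y01] zmax] :=
    @compact_EVT_max _ R (fun z => g z.1 z.2 / f z.1 z.2) A.
- by have [x x1] := E1 m; have [y y1] := E1 n; exists (x, y).
- by apply: compact_setX; exact: compact_sphere.
- apply: continuous_in_subspaceT => z /set_mem[/= /N0 z1 /N0 z2].
  apply: cvgM; first exact: cg.
  by apply: cvgV; [rewrite gt_eqF ?f0|exact: cf].
have x0N0 := N0 _ _ x01; have y0N0 := N0 _ _ y01.
exists x0, y0; split=> // x y xN0 yN0.
have /zmax/= : (`|x|^-1 *: x, `|y|^-1 *: y) \in A.
  by apply: mem_set; split; exact: N1.
rewrite hf hg invfM mulrACA mulfV ?mul1r; last first.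
  by rewrite mulf_neq0 // expf_neq0 // invr_neq0 // normr_eq0.
by rewrite ler_pdivrMr ?f0 // mulrAC ler_pdivlMr ?f0.
Qed.

(** * Forms of size 2 x n *)

Lemma biquadratic0 (R : realType) (U V : lmodType R)
    (F : U -> U -> V -> V -> R) x y :
  biquadratic F -> (x == 0) || (y == 0) -> F x x y y = 0.
Proof.
move=> bqF /orP[/eqP ->|/eqP ->].
  by have := biquadraticZ 0 1 0 y bqF; rewrite scaler0 scale1r expr0n !mul0r.
by have := biquadraticZ 1 0 x 0 bqF; rewrite scaler0 scale1r expr0n mulr0 mul0r.
Qed.

Lemma bilinear_scale (R : realType) (U V : lmodType R) (b : U -> V -> R) c :
  bilinear_form b -> bilinear_form (fun x y => c * b x y).
Proof. by move=> [bl br]; split=> *; rewrite ?bl ?br; ring. Qed.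

Lemma subtract_to_zero (R : realType) (m n : nat)
    (F : 'rV[R]_m.+1 -> 'rV[R]_m.+1 -> 'rV[R]_n.+1 -> 'rV[R]_n.+1 -> R) :
  biquadratic F -> psd F ->
  exists b G x0 y0, [/\ bilinear_form b, biquadratic G, psd G,
    (forall x y, F x x y y = b x y ^+ 2 + G x x y y) &
    [/\ x0 != 0, y0 != 0 & G x0 x0 y0 y0 = 0]].
Proof.
move=> bqF psdF.
have [[x0 [y0 [x0N0 y0N0 F0]]]|noz] := pselect (exists x0 y0,
    [/\ x0 != 0, y0 != 0 & F x0 x0 y0 y0 = 0]).
  exists (fun _ _ => 0), F, x0, y0; split=> //.
    by split=> *; rewrite mulr0 addr0.
  by move=> x y; rewrite expr0n add0r.
have F_gt0 x y : x != 0 -> y != 0 -> 0 < F x x y y.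
  move=> x0 y0; rewrite lt0r psdF andbT; apply/eqP => F0.
  by apply: noz; exists x, y.
(* This form equals 1 on the all-ones vectors, which makes the maximal ratio positive. *)
pose b (x : 'rV[R]_m.+1) (y : 'rV[R]_n.+1) := x 0 0 * y 0 0.
have bP : bilinear_form b by split=> *; rewrite /b !mxE; ring.
have [||||x0 [y0 [x0N0 y0N0 max0]]] := @ratio_max _ m n 2 2
    (fun x y => F x x y y) (fun x y => b x y ^+ 2) _ _ _ _ F_gt0.
- exact: continuous_biquadratic.
- by move=> z; apply: cvgM; exact: continuous_bilinear.
- by move=> c d x y; exact: biquadraticZ.
- by move=> c d x y; rewrite /b !mxE; ring.
have F0 := F_gt0 _ _ x0N0 y0N0.
have b0 : 0 < b x0 y0 ^+ 2.
  have N1 k : const_mx 1 != 0 :> 'rV[R]_k.+1.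
    by apply/rV0Pn; exists 0; rewrite mxE oner_neq0.
  have := max0 _ _ (N1 m) (N1 n); rewrite {1}/b !mxE mulr1 expr1n mul1r => H.
  by rewrite -(pmulr_lgt0 _ (F_gt0 _ _ (N1 m) (N1 n))) (lt_le_trans F0).
pose t := F x0 x0 y0 y0 / b x0 y0 ^+ 2.
have t0 : 0 <= t by rewrite divr_ge0 // ltW.
pose G x z y y' := F x z y y' - t * (b x y * b z y' + b x y' * b z y) / 2.
have bqG : biquadratic G := biquadratic_sub_square t bqF bP.
have GE x y : G x x y y = F x x y y - t * b x y ^+ 2 by rewrite /G; field.
exists (fun x y => Num.sqrt t * b x y), G, x0, y0; split=> //.
- exact: bilinear_scale.
- move=> x y; have [/(biquadratic0 bqG)->//|] := boolP ((x == 0) || (y == 0)).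
  rewrite negb_or => /andP[xN0 yN0]; rewrite GE subr_ge0 /t mulrAC.
  by rewrite ler_pdivrMr // mulrC [leRHS]mulrC max0.
- by move=> x y; rewrite GE exprMn sqr_sqrtr //; ring.
- by split=> //; rewrite GE /t divfK ?subrr // gt_eqF.
Qed.

(* Calderon's theorem: nonnegative 2 x n biquadratic forms are sums of
   squares. At a zero (x0, y0) the 2 x 2 form F(., y0) is singular, hence a
   square, and [sos_peel] removes the direction y0. *)
Lemma sos_2n (R : realType) (n : nat)
    (F : 'rV[R]_2 -> 'rV[R]_2 -> 'rV[R]_n -> 'rV[R]_n -> R) :
  biquadratic F -> psd F -> sos (fun x y => F x x y y).
Proof.
elim: n F => [|n IH] F bqF psdF.
  by apply: sos0 => x y; rewrite biquadratic0 // (thinmx0 y) eqxx orbT.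
have [b [G [x0 [y0 [bP bqG psdG FE [x0N0 y0N0 G0]]]]]] := subtract_to_zero bqF psdF.
apply: (sosS bP _ FE).
have [w [wP Gw]] := square_of_zero bqG psdG x0N0 G0.
exact: (sos_peel bqG psdG y0N0 wP Gw).
Qed.

(** Peeling leaves a 3 x 2 form, and exchanging the two groups of variables makes it 2 x 3. *)
Lemma sos_33_of_rank1 (R : realType)
    (F : 'rV[R]_3 -> 'rV[R]_3 -> 'rV[R]_3 -> 'rV[R]_3 -> R) y0 w :
  biquadratic F -> psd F -> y0 != 0 ->
  (forall a x z, w (a *: x + z) = a * w x + w z) ->
  (forall x, F x x y0 y0 = w x ^+ 2) ->
  sos (fun x y => F x x y y).
Proof.
move=> bqF psdF y0N0 wP Fw; apply: (sos_peel bqF psdF y0N0 wP Fw) => G bqG psdG.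
apply: (sos_swap (f := fun y x => G x x y y)).
by apply: (sos_2n (biquadratic_swap bqG)) => y x; exact: psdG.
Qed.

(** * Symmetric 3 x 3 matrices *)

Lemma psd2 (R : realType) (a b d x y : R) :
  0 <= a -> 0 <= d -> b ^+ 2 <= a * d ->
  0 <= a * x ^+ 2 + 2 * b * x * y + d * y ^+ 2.
Proof.
move=> a0 d0 bad; have [a_eq0|aN0] := eqVneq a 0.
  have b0 : b = 0.
    by apply/eqP; rewrite -sqrf_eq0 eq_le sqr_ge0 andbT (le_trans bad) // a_eq0 mul0r.
  by rewrite a_eq0 b0 !(mulr0, mul0r, add0r) mulr_ge0 ?sqr_ge0.
have a_gt0 : 0 < a by rewrite lt0r aN0.
rewrite -(pmulr_rge0 _ a_gt0).
suff : 0 <= (a * x + b * y) ^+ 2 + (a * d - b ^+ 2) * y ^+ 2.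
  by congr (_ <= _); ring.
by rewrite addr_ge0 ?sqr_ge0 // mulr_ge0 ?sqr_ge0 // subr_ge0.
Qed.

Lemma psd2_det (R : realType) (a b d : R) :
  (forall x y, 0 <= a * x ^+ 2 + 2 * b * x * y + d * y ^+ 2) ->
  [/\ 0 <= a, 0 <= d & b ^+ 2 <= a * d].
Proof.
move=> h; have a0 : 0 <= a by have := h 1 0; rewrite expr1n expr0n /=; lra.
have d0 : 0 <= d by have := h 0 1; rewrite expr1n expr0n /=; lra.
split=> //; have [a_eq0|aN0] := eqVneq a 0.
  have -> : b = 0.
    apply: (@linear_coef_eq0 _ d) => s; have := h s 1; rewrite a_eq0 expr1n; lra.
  by rewrite expr0n /= mulr_ge0.
have a_gt0 : 0 < a by rewrite lt0r aN0.
(* The value at [(- b, a)] is [a * (a * d - b ^+ 2)]. *)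
rewrite -subr_ge0 -(pmulr_rge0 _ a_gt0); have := h (- b) a.
by congr (_ <= _); ring.
Qed.

(** The letters are the upper triangle, read by rows, of the symmetric matrix with rows [a b c],
    [b d e], [c e f]. *)
Definition quad3 (R : realType) (a b c d e f x y z : R) :=
  a * x ^+ 2 + d * y ^+ 2 + f * z ^+ 2 + 2 * b * x * y + 2 * c * x * z + 2 * e * y * z.

Definition det3 (R : realType) (a b c d e f : R) :=
  a * d * f + 2 * b * c * e - a * e ^+ 2 - d * c ^+ 2 - f * b ^+ 2.

(** The second elementary symmetric polynomial of the eigenvalues; on positive semidefinite matrices
    it vanishes exactly when the rank is at most 1. *)
Definition minors3 (R : realType) (a b c d e f : R) :=
  (a * d - b ^+ 2) + (a * f - c ^+ 2) + (d * f - e ^+ 2).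

(** The form in [y] and [z] is [a] times the Schur complement of [a]; its determinant is
    [a * det3 a b c d e f]. *)
Lemma quad3_schur (R : realType) (a b c d e f x y z : R) :
  a * quad3 a b c d e f x y z = (a * x + b * y + c * z) ^+ 2 +
    ((a * d - b ^+ 2) * y ^+ 2 + 2 * (a * e - b * c) * y * z +
     (a * f - c ^+ 2) * z ^+ 2).
Proof. by rewrite /quad3; ring. Qed.

Lemma psd3_minors (R : realType) (a b c d e f : R) :
  (forall x y z, 0 <= quad3 a b c d e f x y z) ->
  [/\ 0 <= a, 0 <= d & 0 <= f] /\
  [/\ b ^+ 2 <= a * d, c ^+ 2 <= a * f, e ^+ 2 <= d * f & 0 <= det3 a b c d e f].
Proof.
rewrite /quad3 => h.
have [a0 d0 bad] : [/\ 0 <= a, 0 <= d & b ^+ 2 <= a * d].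
  by apply: psd2_det => x y; have := h x y 0; rewrite expr0n /=; lra.
have [_ f0 caf] : [/\ 0 <= a, 0 <= f & c ^+ 2 <= a * f].
  by apply: psd2_det => x y; have := h x 0 y; rewrite expr0n /=; lra.
have [_ _ edf] : [/\ 0 <= d, 0 <= f & e ^+ 2 <= d * f].
  by apply: psd2_det => x y; have := h 0 x y; rewrite expr0n /=; lra.
split=> //; split=> //; have [a_eq0|aN0] := eqVneq a 0.
  move: bad caf; rewrite a_eq0 !mul0r => bad caf.
  have b0 : b = 0 by apply/eqP; rewrite -sqrf_eq0 eq_le sqr_ge0 bad.
  have c0 : c = 0 by apply/eqP; rewrite -sqrf_eq0 eq_le sqr_ge0 caf.
  by rewrite /det3 b0 c0 expr0n /= !(mulr0, mul0r, subr0, addr0).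
have a_gt0 : 0 < a by rewrite lt0r aN0.
have [_ _] : [/\ 0 <= a * d - b ^+ 2, 0 <= a * f - c ^+ 2 &
    (a * e - b * c) ^+ 2 <= (a * d - b ^+ 2) * (a * f - c ^+ 2)].
  (* This value of the first variable annihilates the completed square. *)
  apply: psd2_det => y z; have := h (- (b * y + c * z) / a) y z.
  rewrite -(pmulr_rge0 _ a_gt0) quad3_schur.
  rewrite (_ : a * (- (b * y + c * z) / a) + b * y + c * z = 0); last by field.
  by rewrite expr0n add0r.
rewrite -subr_ge0 (_ : _ - _ = a * det3 a b c d e f); last by rewrite /det3; ring.
by rewrite pmulr_rge0.
Qed.

Lemma minors_psd3 (R : realType) (a b c d e f : R) :
  0 <= a -> 0 <= d -> 0 <= f ->
  b ^+ 2 <= a * d -> c ^+ 2 <= a * f -> e ^+ 2 <= d * f ->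
  0 <= det3 a b c d e f ->
  forall x y z, 0 <= quad3 a b c d e f x y z.
Proof.
move=> a0 d0 f0 bad caf edf D0 x y z; have [a_eq0|aN0] := eqVneq a 0.
  move: bad caf; rewrite a_eq0 !mul0r => bad caf.
  have b0 : b = 0 by apply/eqP; rewrite -sqrf_eq0 eq_le sqr_ge0 bad.
  have c0 : c = 0 by apply/eqP; rewrite -sqrf_eq0 eq_le sqr_ge0 caf.
  have := psd2 y z d0 f0 edf; rewrite /quad3 b0 c0; lra.
have a_gt0 : 0 < a by rewrite lt0r aN0.
rewrite -(pmulr_rge0 _ a_gt0) quad3_schur addr_ge0 ?sqr_ge0 //.
apply: psd2; rewrite ?subr_ge0 // -subr_ge0.
rewrite (_ : _ - _ = a * det3 a b c d e f); last by rewrite /det3; ring.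
by rewrite mulr_ge0.
Qed.

(* When the determinant vanishes the diagonal minors pairwise have
   nonnegative products, so the sign of their sum decides all of them. *)
Lemma psd3_of_singular (R : realType) (a b c d e f : R) :
  det3 a b c d e f = 0 -> 0 <= minors3 a b c d e f -> 0 <= a + d + f ->
  forall x y z, 0 <= quad3 a b c d e f x y z.
Proof.
have signs (p q r u v w : R) : p * q = u ^+ 2 -> p * r = v ^+ 2 ->
    q * r = w ^+ 2 -> 0 <= p + q + r -> 0 <= p.
  move=> pq pr qr s; rewrite leNgt; apply/negP => p0.
  have q0 : q <= 0 by rewrite -(nmulr_rge0 _ p0) pq sqr_ge0.
  have r0 : r <= 0 by rewrite -(nmulr_rge0 _ p0) pr sqr_ge0.
  lra.
rewrite /det3 /minors3 => D0 M0 T0.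
(* Principal 2 x 2 minors of the adjugate are diagonal entries times the determinant: the three
   differences are [a], [d] and [f] times 0. *)
have PQ : (a * d - b ^+ 2) * (a * f - c ^+ 2) = (a * e - b * c) ^+ 2.
  by apply/eqP; rewrite -subr_eq0; apply/eqP; rewrite -[RHS](mulr0 a) -D0; ring.
have PR : (a * d - b ^+ 2) * (d * f - e ^+ 2) = (b * e - c * d) ^+ 2.
  by apply/eqP; rewrite -subr_eq0; apply/eqP; rewrite -[RHS](mulr0 d) -D0; ring.
have QR : (a * f - c ^+ 2) * (d * f - e ^+ 2) = (b * f - c * e) ^+ 2.
  by apply/eqP; rewrite -subr_eq0; apply/eqP; rewrite -[RHS](mulr0 f) -D0; ring.
have P0 : 0 <= a * d - b ^+ 2 by exact: (signs _ _ _ _ _ _ PQ PR QR M0).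
have Q0 : 0 <= a * f - c ^+ 2.
  by apply: (signs _ _ _ _ _ _ _ QR PR); [rewrite mulrC; exact: PQ|lra].
have R0 : 0 <= d * f - e ^+ 2.
  by apply: (signs _ _ _ _ _ _ _ _ PQ);
    [rewrite mulrC; exact: PR|rewrite mulrC; exact: QR|lra].
have diag (p q r : R) : 0 <= p * q -> 0 <= p * r -> 0 <= p + q + r -> 0 <= p.
  move=> pq pr s; rewrite leNgt; apply/negP => p0.
  by move: pq pr; rewrite !nmulr_rge0 //; lra.
have ad : 0 <= a * d by have := sqr_ge0 b; lra.
have af : 0 <= a * f by have := sqr_ge0 c; lra.
have df : 0 <= d * f by have := sqr_ge0 e; lra.
have a0 : 0 <= a by exact: (diag _ d f).
have d0 : 0 <= d by apply: (diag _ a f) => //; [rewrite mulrC|lra].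
have f0 : 0 <= f by apply: (diag _ a d); [rewrite mulrC|rewrite mulrC|lra].
by apply: minors_psd3 => //; [lra|lra|lra|rewrite /det3 D0].
Qed.

(** Nonnegative principal minors with sum 0 all vanish; a nonzero diagonal entry then serves as
    pivot for the square. *)
Lemma psd3_rank1 (R : realType) (a b c d e f : R) :
  (forall x y z, 0 <= quad3 a b c d e f x y z) ->
  minors3 a b c d e f = 0 ->
  exists u v w, forall x y z, quad3 a b c d e f x y z = (u * x + v * y + w * z) ^+ 2.
Proof.
move=> h M0; have [[a0 d0 f0] [bad caf edf _]] := psd3_minors h.
move: M0; rewrite /minors3 => M0.
have P0 : a * d = b ^+ 2 by lra.
have Q0 : a * f = c ^+ 2 by lra.
have [a_eq0|aN0] := eqVneq a 0.
  move: P0 Q0; rewrite a_eq0 !mul0r => /esym/eqP; rewrite sqrf_eq0 => /eqP b0.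
  move=> /esym/eqP; rewrite sqrf_eq0 => /eqP c0.
  have R0 : d * f = e ^+ 2 by lra.
  have [d_eq0|dN0] := eqVneq d 0.
    move: R0; rewrite d_eq0 mul0r => /esym/eqP; rewrite sqrf_eq0 => /eqP e0.
    exists 0, 0, (Num.sqrt f) => x y z.
    by rewrite /quad3 b0 c0 e0 !(mul0r, mulr0, addr0, add0r) exprMn sqr_sqrtr.
  have d_gt0 : 0 < d by rewrite lt0r dN0.
  exists 0, (Num.sqrt d), (e / Num.sqrt d) => x y z.
  have sN0 : Num.sqrt d != 0 by rewrite gt_eqF // sqrtr_gt0.
  rewrite /quad3 b0 c0 (_ : f = e ^+ 2 / Num.sqrt d ^+ 2).
    by rewrite -{1}(sqr_sqrtr d0); field.
  by rewrite sqr_sqrtr // -R0 mulrAC mulfV // mul1r.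
have a_gt0 : 0 < a by rewrite lt0r aN0.
(* The scaled Schur complement is nonnegative with zero diagonal, so its off-diagonal entry vanishes
   too. *)
have E0 : a * e - b * c = 0.
  have: forall y z, 0 <= 2 * (a * e - b * c) * y * z.
    move=> y z; have := h (- (b * y + c * z) / a) y z.
    rewrite -(pmulr_rge0 _ a_gt0) quad3_schur P0 Q0 !subrr.
    rewrite (_ : a * (- (b * y + c * z) / a) + b * y + c * z = 0); last by field.
    by rewrite expr0n !mul0r add0r addr0 add0r.
  by move=> H; have := H 1 1; have := H 1 (-1); lra.
pose s := Num.sqrt a; have sE : s ^+ 2 = a by rewrite sqr_sqrtr.
have sN0 : s != 0 by rewrite gt_eqF // sqrtr_gt0.
exists s, (b / s), (c / s) => x y z; apply: (mulfI aN0).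
rewrite quad3_schur P0 Q0 E0 !subrr -{1}sE -[in RHS]sE.
by field.
Qed.

(* Along the pencil T - t u u^T the trace cannot reach 0 while the sum of the
   principal minors stays positive, as (tr T)^2 >= 2 (sum of minors). *)
Lemma minors3_le0_of_traceless (R : realType) (a b c d e f : R) :
  a + d + f = 0 -> minors3 a b c d e f <= 0.
Proof.
move=> T0; have -> : a = - (d + f) by lra.
rewrite /minors3 -oppr_ge0.
have -> : - (- (d + f) * d - b ^+ 2 + (- (d + f) * f - c ^+ 2) + (d * f - e ^+ 2)) =
  ((d + f) ^+ 2 + d ^+ 2 + f ^+ 2) / 2 + b ^+ 2 + c ^+ 2 + e ^+ 2 by field.
by rewrite !addr_ge0 ?sqr_ge0 // divr_ge0 // !addr_ge0 ?sqr_ge0.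
Qed.

(* The determinant of the pencil is linear in t, vanishes at t = 0 and is
   nonnegative at t = 1 and t = -1. *)
Lemma det3_pencil (R : realType) (a b c d e f u v w : R) :
  (forall x y z, (u * x + v * y + w * z) ^+ 2 <= quad3 a b c d e f x y z) ->
  det3 a b c d e f = 0 ->
  forall t, det3 (a - t * u ^+ 2) (b - t * (u * v)) (c - t * (u * w))
    (d - t * v ^+ 2) (e - t * (v * w)) (f - t * w ^+ 2) = 0.
Proof.
move=> h D0.
(* [K] is the quadratic form of the adjugate at [(u, v, w)], as in the matrix determinant lemma. *)
pose K := u ^+ 2 * (d * f - e ^+ 2) + v ^+ 2 * (a * f - c ^+ 2) +
  w ^+ 2 * (a * d - b ^+ 2) + 2 * u * v * (c * e - b * f) +
  2 * u * w * (b * e - c * d) + 2 * v * w * (b * c - a * e).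
have DE t : det3 (a - t * u ^+ 2) (b - t * (u * v)) (c - t * (u * w))
    (d - t * v ^+ 2) (e - t * (v * w)) (f - t * w ^+ 2) = - (t * K).
  by rewrite -[RHS](addr0 _) -D0 /det3 /K; ring.
suff K0 : K = 0 by move=> t; rewrite DE K0 mulr0 oppr0.
(* For [t <= 1] the pencil is the nonnegative form at [t = 1] plus [1 - t] times a square. *)
have pos t : t <= 1 -> 0 <= - (t * K).
  move=> t1; rewrite -DE.
  suff /psd3_minors[_ [_ _ _ //]] : forall x y z, 0 <= quad3 (a - t * u ^+ 2)
    (b - t * (u * v)) (c - t * (u * w)) (d - t * v ^+ 2) (e - t * (v * w))
    (f - t * w ^+ 2) x y z.
  move=> x y z.
  have -> : quad3 (a - t * u ^+ 2)
    (b - t * (u * v)) (c - t * (u * w)) (d - t * v ^+ 2) (e - t * (v * w))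
    (f - t * w ^+ 2) x y z = (quad3 a b c d e f x y z -
      (u * x + v * y + w * z) ^+ 2) + (1 - t) * (u * x + v * y + w * z) ^+ 2.
    by rewrite /quad3; ring.
  by rewrite addr_ge0 ?subr_ge0 // mulr_ge0 ?sqr_ge0 // subr_ge0.
by have := pos 1 (lexx _); have := pos (-1); lra.
Qed.

(** A rank-one matrix has zero 2 x 2 minors, so the sum of minors is affine in [t] along the pencil;
    this is its negated slope. *)
Definition minors3_drop (R : realType) (a b c d e f u v w : R) :=
  minors3 a b c d e f - minors3 (a - u ^+ 2) (b - u * v) (c - u * w)
    (d - v ^+ 2) (e - v * w) (f - w ^+ 2).

Lemma minors3_pencil (R : realType) (a b c d e f u v w t : R) :
  minors3 (a - t * u ^+ 2) (b - t * (u * v)) (c - t * (u * w))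
    (d - t * v ^+ 2) (e - t * (v * w)) (f - t * w ^+ 2) =
  minors3 a b c d e f - t * minors3_drop a b c d e f u v w.
Proof. by rewrite /minors3_drop /minors3; ring. Qed.

(** The quotient is the [t] at which the trace of the pencil vanishes; there the sum of minors is
    already at most 0. *)
Lemma minors3_drop_gt0 (R : realType) (a b c d e f u v w : R) :
  0 <= a + d + f -> 0 < minors3 a b c d e f ->
  0 < u ^+ 2 + v ^+ 2 + w ^+ 2 ->
  0 < minors3_drop a b c d e f u v w /\
  minors3 a b c d e f <= (a + d + f) / (u ^+ 2 + v ^+ 2 + w ^+ 2) *
    minors3_drop a b c d e f u v w.
Proof.
move=> T0 M0 N0; set t := _ / _.
have t0 : 0 <= t by rewrite divr_ge0 // ltW.
have H : minors3 a b c d e f <= t * minors3_drop a b c d e f u v w.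
  rewrite -subr_le0 -minors3_pencil; apply: minors3_le0_of_traceless.
  by rewrite /t; field; rewrite gt_eqF.
split=> //; have := lt_le_trans M0 H.
by case: (ltgtP t 0) t0 => // [t0 _|->]; rewrite ?mul0r ?ltxx // pmulr_rgt0.
Qed.

(** The criterion [psd3_of_singular] applies: the trace is nonnegative because [t] cannot pass the
    point where it vanishes, the sum of minors having to reach 0 no later. *)
Lemma psd3_pencil (R : realType) (a b c d e f u v w t : R) :
  (forall x y z, (u * x + v * y + w * z) ^+ 2 <= quad3 a b c d e f x y z) ->
  det3 a b c d e f = 0 -> 0 < minors3 a b c d e f -> 0 <= t ->
  t * minors3_drop a b c d e f u v w <= minors3 a b c d e f ->
  forall x y z,
    t * (u * x + v * y + w * z) ^+ 2 <= quad3 a b c d e f x y z.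
Proof.
move=> h D0 M0 t0 tM x y z; rewrite -subr_ge0.
have -> : quad3 a b c d e f x y z - t * (u * x + v * y + w * z) ^+ 2 =
    quad3 (a - t * u ^+ 2) (b - t * (u * v)) (c - t * (u * w)) (d - t * v ^+ 2)
      (e - t * (v * w)) (f - t * w ^+ 2) x y z by rewrite /quad3; ring.
apply: psd3_of_singular; first exact: det3_pencil.
  by rewrite minors3_pencil subr_ge0.
have [a0 d0 f0] : [/\ 0 <= a, 0 <= d & 0 <= f].
  have /psd3_minors[] // : forall x y z, 0 <= quad3 a b c d e f x y z.
  by move=> *; apply: le_trans (h _ _ _); exact: sqr_ge0.
set N := u ^+ 2 + v ^+ 2 + w ^+ 2.
have -> : a - t * u ^+ 2 + (d - t * v ^+ 2) + (f - t * w ^+ 2) = a + d + f - t * N.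
  by rewrite /N; ring.
rewrite subr_ge0; have [N_eq0|NN0] := eqVneq N 0.
  by rewrite N_eq0 mulr0 !addr_ge0.
have N0 : 0 < N by rewrite lt0r NN0 !addr_ge0 ?sqr_ge0.
have [B0 MB] := minors3_drop_gt0 (addr_ge0 (addr_ge0 a0 d0) f0) M0 N0.
by rewrite -ler_pdivlMr // -(ler_pM2r B0) (le_trans tM MB).
Qed.

Lemma sum3E (R : realType) (F : 'I_3 -> R) :
  \sum_i F i = F ord0 + F (lift ord0 ord0) + F (lift ord0 (lift ord0 ord0)).
Proof. by rewrite !big_ord_recl big_ord0 addr0 addrA. Qed.

(** The product with ['rV[R]_m] gives functions of [y] alone the shape that [ratio_max] expects. *)
Lemma continuous_quadratic (R : realType) (m n : nat)
    (b : 'rV[R]_n -> 'rV[R]_n -> R) :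
  bilinear_form b -> continuous (fun z : 'rV[R]_m * 'rV[R]_n => b z.2 z.2).
Proof.
move=> bP; under eq_fun do rewrite (bilinearE _ _ bP).
apply: continuous_sum => i; apply: continuous_sum => j z.
apply: cvgM; first exact: cvg_cst.
by apply: cvgM; exact: continuous_coord_snd.
Qed.

Lemma continuous_minors3 (R : realType) (T : topologicalType)
    (a b c d e f : T -> R) :
  continuous a -> continuous b -> continuous c -> continuous d ->
  continuous e -> continuous f ->
  continuous (fun z => minors3 (a z) (b z) (c z) (d z) (e z) (f z)).
Proof.
move=> ca cb cc cd ce cf z.
have cM (g h : T -> R) : continuous g -> continuous h ->
    {for z, continuous (fun x => g x * h x)}.
  by move=> cg ch; apply: cvgM; [exact: cg|exact: ch].
rewrite /minors3; apply: cvgD; [apply: cvgD|]; apply: cvgB; exact: cM.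
Qed.

(** * Singular 3 x 3 forms *)

Lemma bilinearZ (R : realType) (U V : lmodType R) (b : U -> V -> R) c d x y :
  bilinear_form b -> b (c *: x) (d *: y) = c * d * b x y.
Proof.
move=> [bl br]; rewrite -[c *: x]addr0 -[d *: y]addr0 bl !br.
have z0 u : b 0 u = 0 by have := bl 1 0 0 u; rewrite scaler0 addr0; lra.
have z1 u : b u 0 = 0 by have := br 1 u 0 0; rewrite scaler0 addr0; lra.
by rewrite !z0 !z1; ring.
Qed.

Lemma quad3_surj (R : realType) (P : R -> R -> R -> Prop) :
  (forall x : 'rV[R]_3,
    P (x 0 ord0) (x 0 (lift ord0 ord0)) (x 0 (lift ord0 (lift ord0 ord0)))) ->
  forall x y z, P x y z.
Proof. by move=> h x y z; have := h (\row_k nth 0 [:: x; y; z] k); rewrite !mxE. Qed.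

Lemma linear3 (R : realType) (u v w : R) a (x z : 'rV[R]_3) (i j k : 'I_3) :
  u * (a *: x + z) 0 i + v * (a *: x + z) 0 j + w * (a *: x + z) 0 k =
  a * (u * x 0 i + v * x 0 j + w * x 0 k) + (u * z 0 i + v * z 0 j + w * z 0 k).
Proof. by rewrite !mxE; ring. Qed.

(* Either F(., y0) is already a square for some y0 != 0, or the largest t with
   F - t b^2 >= 0 (attained on the unit sphere) makes it a square. *)
Lemma sos_33_of_singular (R : realType)
    (F : 'rV[R]_3 -> 'rV[R]_3 -> 'rV[R]_3 -> 'rV[R]_3 -> R)
    (b : 'rV[R]_3 -> 'rV[R]_3 -> R) (x1 y1 : 'rV[R]_3) :
  let e0 := delta_mx 0 ord0 in
  let e1 := delta_mx 0 (lift ord0 ord0) in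
  let e2 := delta_mx 0 (lift ord0 (lift ord0 ord0)) in
  biquadratic F -> bilinear_form b -> b x1 y1 != 0 ->
  (forall x y, b x y ^+ 2 <= F x x y y) ->
  (forall y, det3 (F e0 e0 y y) (F e0 e1 y y) (F e0 e2 y y)
     (F e1 e1 y y) (F e1 e2 y y) (F e2 e2 y y) = 0) ->
  sos (fun x y => F x x y y).
Proof.
move=> e0 e1 e2 bqF bP b1 bF D0; have [Cl Cr Pl Pr] := bqF; have [bl br] := bP.
have psdF : psd F by move=> x y; rewrite (le_trans _ (bF x y)) ?sqr_ge0.
have FE x y : F x x y y = quad3 (F e0 e0 y y) (F e0 e1 y y) (F e0 e2 y y)
    (F e1 e1 y y) (F e1 e2 y y) (F e2 e2 y y) (x 0 ord0) (x 0 (lift ord0 ord0))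
    (x 0 (lift ord0 (lift ord0 ord0))).
  rewrite (bilinearE (b := fun x z => F x z y y)); last first.
    by split=> c p q r; [rewrite Pl|rewrite !(Cl p) Pl].
  by rewrite !sum3E (Cl e1 e0) (Cl e2 e0) (Cl e2 e1) /quad3; ring.
have bE x y : b x y = b e0 y * x 0 ord0 + b e1 y * x 0 (lift ord0 ord0) +
    b e2 y * x 0 (lift ord0 (lift ord0 ord0)).
  by rewrite (linear_rowE (fun a u v => bl a u v y)) sum3E; ring.
have hy y : forall x x' x'', (b e0 y * x + b e1 y * x' + b e2 y * x'') ^+ 2 <=
    quad3 (F e0 e0 y y) (F e0 e1 y y) (F e0 e2 y y)
    (F e1 e1 y y) (F e1 e2 y y) (F e2 e2 y y) x x' x''.
  by apply: quad3_surj => x; rewrite -bE -FE.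
have qy y : forall x x' x'', 0 <= quad3 (F e0 e0 y y) (F e0 e1 y y) (F e0 e2 y y)
    (F e1 e1 y y) (F e1 e2 y y) (F e2 e2 y y) x x' x''.
  by apply: quad3_surj => x; rewrite -FE.
pose alpha y := minors3 (F e0 e0 y y) (F e0 e1 y y) (F e0 e2 y y)
  (F e1 e1 y y) (F e1 e2 y y) (F e2 e2 y y).
pose beta y := minors3_drop (F e0 e0 y y) (F e0 e1 y y) (F e0 e2 y y)
  (F e1 e1 y y) (F e1 e2 y y) (F e2 e2 y y) (b e0 y) (b e1 y) (b e2 y).
have [[y0 [y0N0 a0]]|no_rank1] := pselect (exists y0, y0 != 0 /\ alpha y0 = 0).
  have [u [v [w Q]]] := psd3_rank1 (qy y0) a0.
  apply: (sos_33_of_rank1 (w := fun x => u * x 0 ord0 + v * x 0 (lift ord0 ord0)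
    + w * x 0 (lift ord0 (lift ord0 ord0))) bqF psdF y0N0).
    by move=> *; exact: linear3.
  by move=> x; rewrite FE Q.
have a_gt0 y : y != 0 -> 0 < alpha y.
  move=> yN0; rewrite lt0r; apply/andP; split.
    by apply/eqP => a0; apply: no_rank1; exists y.
  have [_ [m1 m2 m3 _]] := psd3_minors (qy y).
  rewrite /alpha /minors3; lra.
have bF2 i k : bilinear_form (fun y y' => F i k y y').
  by split=> c p q r; [rewrite Pr|rewrite !(Cr _ _ p) Pr].
have bB2 i k : bilinear_form (fun y y' => b i y * b k y').
  by split=> *; rewrite br; ring.
have cF i k := @continuous_quadratic R 1 3 _ (bF2 i k).
have cB i k := @continuous_quadratic R 1 3 _ (bB2 i k).
have FZ i k c y : F i k (c *: y) (c *: y) = c ^+ 2 * F i k y y.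
  by rewrite (bilinearZ c c y y (bF2 i k)) expr2.
have bZ i c y : b i (c *: y) = c * b i y.
  by rewrite -{1}[i]scale1r (bilinearZ 1 c i y bP) mul1r.
(* The auxiliary [x] ranges over a line with degree 0. The degree in [y] is 4: the minors are
   quadratic in entries that are quadratic in [y]. *)
have [||||x0 [y0 [x0N0 y0N0 max0]]] := @ratio_max _ 0 2 0 4
    (fun x y => alpha y) (fun x y => beta y) _ _ _ _ (fun x y _ => a_gt0 y).
- by apply: continuous_minors3; exact: cF.
- move=> z; rewrite /beta /minors3_drop; apply: cvgB; move: z.
    by apply: continuous_minors3; exact: cF.
  by apply: continuous_minors3 => z; apply: cvgB; [exact: cF|exact: cB|exact: cF
    |exact: cB|exact: cF|exact: cB|exact: cF|exact: cB|exact: cF|exact: cB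
    |exact: cF|exact: cB].
- by move=> a c x y; rewrite /alpha !FZ /minors3 expr0; ring.
- by move=> a c x y; rewrite /beta !FZ !bZ /minors3_drop /minors3 expr0; ring.
have y1N0 : y1 != 0.
  by apply: contraNneq b1 => ->; have := bZ x1 0 0; rewrite scale0r mul0r => ->.
(* Since [b x1 y1 != 0], the coefficients of [b] at [y1] are not all zero; hence [beta y1 > 0], and
   the maximal ratio is positive. *)
have b0 : 0 < beta y0.
  have [[p0 p1 p2] _] := psd3_minors (qy y1).
  have N0 : 0 < b e0 y1 ^+ 2 + b e1 y1 ^+ 2 + b e2 y1 ^+ 2.
    rewrite lt0r !addr_ge0 ?sqr_ge0 // andbT; apply: contraNN b1.
    rewrite !paddr_eq0 ?addr_ge0 ?sqr_ge0 // !sqrf_eq0 (bE x1).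
    by move=> /andP[/andP[/eqP-> /eqP->] /eqP->]; rewrite !mul0r !addr0.
  have [B1 _] := minors3_drop_gt0 (addr_ge0 (addr_ge0 p0 p1) p2) (a_gt0 _ y1N0) N0.
  rewrite -(pmulr_lgt0 _ (a_gt0 _ y1N0)) (lt_le_trans _ (max0 _ _ x0N0 y1N0)) //.
  by rewrite mulr_gt0 // a_gt0.
pose t := alpha y0 / beta y0.
have t0 : 0 <= t by rewrite divr_ge0 // ltW // a_gt0.
pose G x z y y' := F x z y y' - t * (b x y * b z y' + b x y' * b z y) / 2.
have bqG : biquadratic G := biquadratic_sub_square t bqF bP.
have GE x y : G x x y y = F x x y y - t * b x y ^+ 2 by rewrite /G; field.
have psdG : psd G.
  move=> x y; have [->|yN0] := eqVneq y 0.
    by rewrite (biquadratic0 (F := G)) // eqxx orbT.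
  rewrite GE subr_ge0 bE FE; apply: psd3_pencil => //; first exact: a_gt0.
  by rewrite /t mulrAC ler_pdivrMr // mulrC [leRHS]mulrC (max0 _ _ x0N0 yN0).
apply: (sosS (bilinear_scale (Num.sqrt t) bP) (g := fun x y => G x x y y)); last first.
  by move=> x y; rewrite GE exprMn sqr_sqrtr //; ring.
have [u [v [w Q]]] : exists u v w, forall x y z,
    quad3 (F e0 e0 y0 y0 - t * b e0 y0 ^+ 2) (F e0 e1 y0 y0 - t * (b e0 y0 * b e1 y0))
      (F e0 e2 y0 y0 - t * (b e0 y0 * b e2 y0)) (F e1 e1 y0 y0 - t * b e1 y0 ^+ 2)
      (F e1 e2 y0 y0 - t * (b e1 y0 * b e2 y0)) (F e2 e2 y0 y0 - t * b e2 y0 ^+ 2)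
      x y z = (u * x + v * y + w * z) ^+ 2.
  (* By the choice of [t], the sum of minors [alpha y0 - t * beta y0] is 0. *)
  apply: psd3_rank1; last by rewrite minors3_pencil /t divfK ?subrr // gt_eqF.
  apply: quad3_surj => x; have := psdG x y0; rewrite GE bE FE.
  by congr (_ <= _); rewrite /quad3; ring.
apply: (sos_33_of_rank1 (w := fun x => u * x 0 ord0 + v * x 0 (lift ord0 ord0)
    + w * x 0 (lift ord0 (lift ord0 ord0))) bqG psdG y0N0).
  by move=> *; exact: linear3.
by move=> x; rewrite -Q GE bE FE /quad3; ring.
Qed.

(** * Sums of squares and polyconvexity *)

Lemma det_mx22 (R : realType) (A : 'M[R]_2) :
  \det A = A ord0 ord0 * A (lift ord0 ord0) (lift ord0 ord0) -
           A ord0 (lift ord0 ord0) * A (lift ord0 ord0) ord0.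
Proof.
rewrite (expand_det_row _ ord0) !big_ord_recl big_ord0 /cofactor !det_mx11 !mxE /=.
rewrite (_ : lift (lift ord0 ord0) 0 = ord0 :> 'I_2); last exact: val_inj.
rewrite (_ : lift ord0 0 = lift ord0 ord0 :> 'I_2); last exact: val_inj.
by rewrite /bump /= expr0 expr1; ring.
Qed.

Lemma lift3E :
  let i0 : 'I_3 := ord0 in let i1 : 'I_3 := lift ord0 ord0 in
  let i2 : 'I_3 := lift ord0 (lift ord0 ord0) in
  (lift i1 ord0 = i0) * (lift i1 (lift ord0 ord0) = i2) *
  (lift i2 ord0 = i0) * (lift i2 (lift ord0 ord0) = i1).
Proof. by do !split; exact: val_inj. Qed.

Lemma det_sym33 (R : realType) (A : 'M[R]_3) :
  A^T = A ->
  \det A = det3 (A ord0 ord0) (A ord0 (lift ord0 ord0))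
    (A ord0 (lift ord0 (lift ord0 ord0))) (A (lift ord0 ord0) (lift ord0 ord0))
    (A (lift ord0 ord0) (lift ord0 (lift ord0 ord0)))
    (A (lift ord0 (lift ord0 ord0)) (lift ord0 (lift ord0 ord0))).
Proof.
move=> symA; have sA i j : A i j = A j i by rewrite -{1}symA mxE.
rewrite (expand_det_row _ ord0) sum3E /cofactor !det_mx22 !mxE /= !lift3E.
rewrite (sA (lift ord0 ord0) ord0) (sA (lift ord0 (lift ord0 ord0)) ord0).
rewrite (sA (lift ord0 (lift ord0 ord0)) (lift ord0 ord0)).
by rewrite /bump /= !add1n expr0 expr1 /det3; ring.
Qed.

Lemma quad_formD (R : realType) (C D : 'I_3 -> 'I_3 -> 'I_3 -> 'I_3 -> R) c xi :
  quad_form (fun i j k l => C i j k l + c * D i j k l) xi =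
  quad_form C xi + c * quad_form D xi.
Proof.
rewrite /quad_form.
do 4 (rewrite mulr_sumr -big_split; apply: eq_bigr => ? _ /=).
by ring.
Qed.

Lemma rank_one_formE (R : realType) (B xi : 'M[R]_3) :
  rank_one_form B xi = quad_form (fun i j k l => B i j * B k l) xi.
Proof.
rewrite /rank_one_form /quad_form expr2 mulr_suml; apply: eq_bigr => i _.
rewrite mulr_suml; apply: eq_bigr => j _; rewrite mulr_sumr; apply: eq_bigr => k _.
by rewrite mulr_sumr; apply: eq_bigr => l _; ring.
Qed.

Lemma tensorE (R : realType) (x y : 'rV[R]_3) i j : tensor x y i j = x 0 i * y 0 j.
Proof. by rewrite /tensor !mxE big_ord1 !mxE. Qed.

(** A bilinear form in [x] and [y] is a linear form evaluated at [tensor x y], so each square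
    extends to all matrices as a nonnegative form. *)
Lemma sos_convex (R : realType) (f : 'rV[R]_3 -> 'rV[R]_3 -> R) :
  sos f -> exists D, (forall xi, 0 <= quad_form D xi) /\
    (forall x y, f x y = quad_form D (tensor x y)).
Proof.
elim=> {f} [f f0|f g b bP _ [D [D0 gE]] fE].
  exists (fun _ _ _ _ => 0).
  have Z xi : quad_form (fun _ _ _ _ => 0 : R) xi = 0.
    by rewrite /quad_form; do 4 (apply: big1 => ? _); rewrite !mul0r.
  by split=> *; rewrite Z // f0.
pose B := \matrix_(i, j) b (delta_mx 0 i) (delta_mx 0 j).
exists (fun i j k l => D i j k l + 1 * (B i j * B k l)).
split=> [xi|x y]; rewrite quad_formD -rank_one_formE mul1r.
  by rewrite addr_ge0 // sqr_ge0.
rewrite fE gE addrC; congr (_ + _); rewrite /rank_one_form; congr (_ ^+ 2).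
rewrite (bilinearE _ _ bP); apply: eq_bigr => i _; apply: eq_bigr => j _.
by rewrite tensorE mxE.
Qed.

(** Polarizing in both variables isolates the terms in which [i], [k] index the x-factors and [j],
    [l] the y-factors. *)
Lemma quad_form_null_coef (R : realType) (E : 'I_3 -> 'I_3 -> 'I_3 -> 'I_3 -> R) :
  (forall x y, quad_form E (tensor x y) = 0) ->
  forall i j k l, E i j k l + E k l i j + E i l k j + E k j i l = 0.
Proof.
move=> E0.
pose P (x y z t : 'rV[R]_3) := \sum_a x 0 a * (\sum_b y 0 b *
  (\sum_c z 0 c * (\sum_d t 0 d * E a b c d))).
have PE i j k l : P (delta_mx 0 i) (delta_mx 0 j) (delta_mx 0 k) (delta_mx 0 l) =
    E i j k l.
  have S (G : 'I_3 -> R) a : \sum_b (delta_mx 0 a : 'rV[R]_3) 0 b * G b = G a.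
    rewrite (bigD1 a) //= big1 ?addr0 => [|b ba]; rewrite mxE eqxx /=.
      by rewrite eqxx mul1r.
    by rewrite (negPf ba) mul0r.
  by rewrite /P !S.
have P1 x x' y z t : P (x + x') y z t = P x y z t + P x' y z t.
  by rewrite /P -big_split /=; apply: eq_bigr => a _; rewrite mxE mulrDl.
have P2 x y y' z t : P x (y + y') z t = P x y z t + P x y' z t.
  rewrite /P -big_split /=; apply: eq_bigr => a _; rewrite -mulrDr -big_split /=.
  by congr (_ * _); apply: eq_bigr => b _; rewrite mxE mulrDl.
have P3 x y z z' t : P x y (z + z') t = P x y z t + P x y z' t.
  rewrite /P -big_split /=; apply: eq_bigr => a _; rewrite -mulrDr -big_split /=.
  congr (_ * _); apply: eq_bigr => b _; rewrite -mulrDr -big_split /=.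
  by congr (_ * _); apply: eq_bigr => c _; rewrite mxE mulrDl.
have P4 x y z t t' : P x y z (t + t') = P x y z t + P x y z t'.
  rewrite /P -big_split /=; apply: eq_bigr => a _; rewrite -mulrDr -big_split /=.
  congr (_ * _); apply: eq_bigr => b _; rewrite -mulrDr -big_split /=.
  congr (_ * _); apply: eq_bigr => c _; rewrite -mulrDr -big_split /=.
  by congr (_ * _); apply: eq_bigr => d _; rewrite mxE mulrDl.
have P0 x y : P x y x y = 0.
  rewrite -[RHS](E0 x y) /P /quad_form; apply: eq_bigr => a _.
  rewrite mulr_sumr; apply: eq_bigr => b _; rewrite 2!mulr_sumr.
  apply: eq_bigr => c _; rewrite 3!mulr_sumr; apply: eq_bigr => d _.
  by rewrite !tensorE; ring.
move=> i j k l; rewrite -!PE.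
set x := delta_mx 0 i; set y := delta_mx 0 j; set z := delta_mx 0 k.
set t := delta_mx 0 l.
(* Inclusion-exclusion over nine evaluations leaves only the four fully mixed terms. *)
have := P0 (x + z) (y + t).
have := (P0 x (y + t), P0 z (y + t), P0 (x + z) y, P0 (x + z) t).
have := (P0 x y, P0 x t, P0 z y, P0 z t).
rewrite !(P1, P2, P3, P4) => -[[[-> ->] ->] ->] [[[? ?] ?] ?]; lra.
Qed.

Lemma quad_form_null (R : realType) (E : 'I_3 -> 'I_3 -> 'I_3 -> 'I_3 -> R) :
  (forall x y, quad_form E (tensor x y) = 0) ->
  exists A, forall xi, quad_form E xi = minors_comb A xi.
Proof.
move=> /quad_form_null_coef sym0.
pose j0 : 'I_2 := ord0; pose j1 : 'I_2 := lift ord0 ord0.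
(* Each weight is the coefficient in [E] of the main diagonal product of the corresponding minor;
   the minors carry no cofactor sign. *)
exists (\matrix_(p < 3, q < 3)
  (E (lift p j0) (lift q j0) (lift p j1) (lift q j1) +
   E (lift p j1) (lift q j1) (lift p j0) (lift q j0))).
move=> xi; rewrite /quad_form /minors_comb !sum3E !mxE !det_mx22 !mxE /j0 /j1 !lift3E.
pose i0 : 'I_3 := ord0; pose i1 : 'I_3 := lift ord0 ord0.
pose i2 : 'I_3 := lift ord0 (lift ord0 ord0).
rewrite -/i2 -/i1 -/i0.
(* Squares drop out, products within one row or one column cancel in pairs, and [m] expresses
   antidiagonal products through diagonal ones. *)
have d i j : E i j i j = 0 by have := sym0 i j i j; lra.
have r i j l : E i l i j = - E i j i l by have := sym0 i j i l; lra.
have c i j k : E k j i j = - E i j k j by have := sym0 i j k j; lra.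
have m i j k l : E k j i l = - E i j k l - E k l i j - E i l k j.
  by have := sym0 i j k l; lra.
rewrite !d.
rewrite !(r _ i0 i1) !(r _ i0 i2) !(r _ i1 i2) !(c i0 _ i1) !(c i0 _ i2) !(c i1 _ i2).
rewrite (m i0 i0 i1 i1) (m i0 i0 i1 i2) (m i0 i1 i1 i2).
rewrite (m i0 i0 i2 i1) (m i0 i0 i2 i2) (m i0 i1 i2 i2).
rewrite (m i1 i0 i2 i1) (m i1 i0 i2 i2) (m i1 i1 i2 i2).
ring.
Qed.

(** The form and its convex part agree on rank-one matrices, so their difference is a
    Null-Lagrangian. *)
Lemma sos_polyconvex (R : realType) (C : 'I_3 -> 'I_3 -> 'I_3 -> 'I_3 -> R) :
  sos (fun x y => quad_form C (tensor x y)) -> polyconvex (quad_form C).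
Proof.
move=> /sos_convex[D [D0 CD]].
have [|A AE] := @quad_form_null R (fun i j k l => C i j k l + -1 * D i j k l).
  by move=> x y; rewrite quad_formD CD; ring.
by exists D, A; split=> // xi; rewrite -AE quad_formD; ring.
Qed.

(** * From the acoustic tensor to the theorem *)

Lemma bilinear_form_mx (R : realType) (m n : nat) (B : 'M[R]_(m, n)) :
  bilinear_form (fun (x : 'rV[R]_m) (y : 'rV[R]_n) => (x *m B *m y^T) 0 0).
Proof.
split=> a x y z; first by rewrite !mulmxDl -!scalemxAl !mxE.
by rewrite linearD linearZ /= mulmxDr -scalemxAr !mxE.
Qed.

Lemma y_matrix_polarization (R : realType) (f : 'M[R]_3 -> R)
    (T : 'rV[R]_3 -> 'M[R]_3) :
  is_y_matrix f T ->
  exists F : 'rV[R]_3 -> 'rV[R]_3 -> 'rV[R]_3 -> 'rV[R]_3 -> R,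
    [/\ biquadratic F, forall x y, F x x y y = f (tensor x y) &
        forall y i k, F (delta_mx 0 i) (delta_mx 0 k) y y = T y i k].
Proof.
move=> [symT [D TD] fT].
(* The polarization of [T]; it is bilinear because the entries of [T] are quadratic forms. *)
pose S y t : 'M[R]_3 := 2^-1 *: (T (y + t) - T y - T t).
have sT y i k : T y i k = T y k i by rewrite -{1}symT mxE.
have symS y t : (S y t)^T = S y t by apply/matrixP => i k; rewrite !mxE !(sT _ k i).
have SC y t : S y t = S t y by rewrite /S [t + y]addrC addrAC.
have quadD i k y t : ((y + t) *m D i k *m (y + t)^T) 0 0 =
    (y *m D i k *m y^T) 0 0 + (y *m D i k *m t^T) 0 0 +
    (t *m D i k *m y^T) 0 0 + (t *m D i k *m t^T) 0 0.
  by rewrite linearD /= !mulmxDl !mulmxDr !mxE; ring.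
have SD y t i k : S y t i k = 2^-1 * ((y *m D i k *m t^T) 0 0 + (t *m D i k *m y^T) 0 0).
  have -> : S y t i k = 2^-1 * (T (y + t) i k - T y i k - T t i k) by rewrite !mxE.
  by rewrite !TD quadD; ring.
have Syy y : S y y = T y by apply/matrixP => i k; rewrite SD TD; field.
have SP a y t z : S (a *: y + t) z = a *: S y z + S t z.
  apply/matrixP => i k; have [Dl Dr] := bilinear_form_mx (D i k).
  by rewrite [RHS]mxE [X in _ = X + _]mxE !SD Dl Dr; ring.
exists (fun x z y t => (x *m S y t *m z^T) 0 0); split.
- split=> [x z y t|x z y t|a x z t y y'|a x z y t y'].
  + have tr (M : 'M[R]_1) : M 0 0 = M^T 0 0 by rewrite mxE.
    by rewrite tr !trmx_mul trmxK symS mulmxA.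
  + by rewrite SC.
  + by rewrite !mulmxDl -!scalemxAl !mxE.
  + by rewrite SP mulmxDr mulmxDl -scalemxAr -scalemxAl !mxE.
- by move=> x y; rewrite Syy fT.
- by move=> y i k; rewrite Syy trmx_delta -rowE -colE !mxE.
Qed.

Theorem theorem2p6 (R : realType)
    (C : 'I_3 -> 'I_3 -> 'I_3 -> 'I_3 -> R)
    (T : 'rV[R]_3 -> 'M[R]_3)
    (hqc : quasiconvex (quad_form C))
    (hT : is_y_matrix (quad_form C) T)
    (hdet : forall y : 'rV[R]_3, \det (T y) = 0) :
  extremal (quad_form C) \/ polyconvex (quad_form C).
Proof.
have [|not_extremal] := pselect (extremal (quad_form C)); [by left|right].
have [B [B_neq0 hB]] : exists B : 'M[R]_3, B != 0 /\
    quasiconvex (fun xi => quad_form C xi - rank_one_form B xi).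
  by apply: contrapT => noB; apply: not_extremal.
have [symT _ _] := hT.
have [F [bqF FE FT]] := y_matrix_polarization hT.
pose b (x y : 'rV[R]_3) := (x *m B *m y^T) 0 0.
have bP : bilinear_form b := bilinear_form_mx B.
have bB i j : b (delta_mx 0 i) (delta_mx 0 j) = B i j.
  by rewrite /b trmx_delta -rowE -colE !mxE.
(* A nonzero entry of [B] provides the pair of basis vectors at which [b] does not vanish. *)
have [i [j Bij]] : exists i j, B i j != 0.
  apply: contrapT => B0; move/eqP: B_neq0; apply; apply/matrixP => i j.
  by rewrite mxE; apply/eqP; apply: contrapT => Bij; apply: B0; exists i, j; apply/negP.
apply: sos_polyconvex.
suff : sos (fun x y => F x x y y) by under [X in sos X]eq2_fun do rewrite FE.
apply: (sos_33_of_singular (b := b) (x1 := delta_mx 0 i) (y1 := delta_mx 0 j)) => //.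
- by rewrite bB.
- move=> x y; rewrite FE -subr_ge0; have := hB x y.
  congr (_ <= _ - _); rewrite /rank_one_form (bilinearE _ _ bP); congr (_ ^+ 2).
  by apply: eq_bigr => ? _; apply: eq_bigr => ? _; rewrite bB tensorE.
- by move=> y; rewrite !FT -det_sym33.
Qed.
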